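(* Let $m\ge 2$ be an integer, $A=[a]_m$, $B=[b]_m\in\mathbb{Z}_m$, and let $F_n=[f_n]_m$ $(n\in\mathbb{Z}_+)$ be a sequence in $\mathbb{Z}_m$, where $a,b,f_n\in\mathbb{Z}$. Consider the equation (E) for sequences $\{X_n\}_{n=0}^\infty$ in $\mathbb{Z}_m$: $$BX_{n+1}=AX_n+F_n,\quad n\in\mathbb{Z}_+.$$ With $d,m_1,m_2,m',A_i,B_i,F_{i,n},A',B',F_n',\psi$ as defined in the context, the following hold. 1. (E) has a finite nonzero number of solutions if and only if $d=1$. Moreover, in this case the number of solutions is equal to $m_1$, and: (a) if $m_2=1$, the general solution of (E) is $$X_n=B^{-n}A^nX_0+\sum_{s=0}^{n-1}A^sB^{-s-1}F_{n-s-1},\quad n\in\mathbb{N},$$ where $X_0$ is an arbitrary element of $\mathbb{Z}_m$; (b) if $m_1=1$, the unique solution of (E) is $$X_n=-\sum_{s=0}^{\mathrm{ind}(B)-1}A^{-s-1}B^sF_{n+s},\quad n\in\mathbb{Z}_+;$$ (c) if $m_1\neq1$ and $m_2\ne1$, the general solution of (E) is $$X_0=\psi\Big(X_{1,0},\ -\sum_{s=0}^{\mathrm{ind}(B_2)-1}A_2^{-s-1}B_2^sF_{2,s}\Big),$$ $$X_n=\psi\Big(B_1^{-n}A_1^nX_{1,0}+\sum_{s=0}^{n-1}A_1^sB_1^{-s-1}F_{1,n-s-1},\ -\sum_{s=0}^{\mathrm{ind}(B_2)-1}A_2^{-s-1}B_2^sF_{2,n+s}\Big),\quad n\in\mathbb{N},$$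 where $X_{1,0}$ is an arbitrary element of $\mathbb{Z}_{m_1}$. 2. (E) has infinitely many solutions if and only if $d\neq1$ and $d\mid f_n$ for all $n\in\mathbb{Z}_+$. In this case the general solution is $$X_n=[x_n'+\alpha_nm']_m,\quad n\in\mathbb{Z}_+,$$ where $X_n'=[x_n']_{m'}$ $(n\in\mathbb{Z}_+)$ is the general solution of the equation $B'X'_{n+1}=A'X'_n+F'_n$ $(n\in\mathbb{Z}_+)$ over $\mathbb{Z}_{m'}$, and $\{\alpha_n\}_{n=0}^\infty$ is an arbitrary sequence of elements of $\{0,\ldots,d-1\}$. Moreover, the sequence $\{\alpha_n\}_{n=0}^\infty$ and the solution $\{X'_n\}_{n=0}^\infty$, with $x'_n\in\{0,\ldots,m'-1\}$, are uniquely determined by the solution $\{X_n\}_{n=0}^\infty$ of (E). 3. (E) has no solutions if and only if $d\nmid f_n$ for some $n\in\mathbb{Z}_+$.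
   Context: $\mathbb{Z}_+$ is the set of non-negative integers, $\mathbb{N}$ the positive integers. $\mathbb{Z}_s=\mathbb{Z}/s\mathbb{Z}$ and $[t]_s$ is the class of $t\in\mathbb{Z}$ in $\mathbb{Z}_s$; $\mathbb{Z}_1$ is the null ring. For a nilpotent element $T$, $\mathrm{ind}(T)$ is its nilpotency index (least $k\ge1$ with $T^k=0$). Zeroth powers are $1$. Write $m=\prod_{j=1}^r p_j^{k_j}$ with distinct primes $p_j$ and $k_j\in\mathbb{N}$. Put $m_1=\prod_{j:\,p_j\nmid b}p_j^{k_j}$, $m_2=\prod_{j:\,p_j\mid b}p_j^{k_j}$ (empty products are $1$); so $m=m_1m_2$ and $\gcd(m_1,m_2)=1$. Put $d=\gcd(a,b,m)$ (positive). For $i=1,2$: $A_i=[a]_{m_i}$, $B_i=[b]_{m_i}$, $F_{i,n}=[f_n]_{m_i}$. If $m_1\ne1$ and $m_2\neq 1$, $\psi:\mathbb{Z}_{m_1}\oplus\mathbb{Z}_{m_2}\to\mathbb{Z}_m$ is the ring isomorphism $\psi([t_1]_{m_1},[t_2]_{m_2})=[t_1e_1m_2+t_2e_2m_1]_m$, where $[e_1]_{m_1}=[m_2]_{m_1}^{-1}$, $[e_2]_{m_2}=[m_1]_{m_2}^{-1}$. Put $m'=m/d$, $A'=[a/d]_{m'}$, $B'=[b/d]_{m'}$, and, when $d\mid f_n$ for all $n$, $F_n'=[f_n/d]_{m'}$. The formulas make sense: $B_1$ is invertible if $m_1\neq1$; $B_2$ is nilpotent if $m_2\ne1$, and then $A_2$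 is invertible if $d=1$. (If $m_2=1$ then $B=B_1$; if $m_1=1$ then $B=B_2$, $A=A_2$.) *)

(* Defs.v *)
From HB Require Import structures.
From mathcomp Require Import all_boot all_order all_algebra.
From mathcomp Require Import boolp classical_sets functions cardinality.

Set Implicit Arguments.
Unset Strict Implicit.
Unset Printing Implicit Defensive.

Import GRing.Theory.

Local Open Scope ring_scope.
Local Open Scope classical_set_scope.

(* Z/sZ for every s >= 1, including the null ring for s = 1 (which 'Z_1 is
   not: it denotes Z/2Z).  The class of t : int is t%:~R. *)
Definition Zmod (s : nat) : Type := 'I_s.-1.+1.

HB.instance Definition _ (s : nat) := GRing.Zmodule.on (Zmod s).
HB.instance Definition _ (s : nat) :=
  GRing.Zmodule_isComPzRing.Build (Zmod s)
    (@Zp_mulA s.-1.+1) (@Zp_mulC s.-1.+1) (@Zp_mul1z s.-1)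
    (@Zp_mul_addl s.-1.+1).

Definition solutions (R : pzRingType) (A B : R) (F : nat -> R) :
    set (nat -> R) :=
  [set X | forall n, B * X n.+1 = A * X n + F n].

(* The value 0 is only taken when T is not nilpotent. *)
Definition nilp_index (R : pzRingType) (T : R) : nat :=
  if pselect (exists k, (0 < k)%N && (T ^+ k == 0)) is left exT
  then ex_minn exT else 0.

Definition gcd_abm (a b : int) (m : nat) : nat :=
  gcdn (gcdn `|a| `|b|) m.

Definition coprime_part (m : nat) (b : int) : nat :=
  \prod_(p <- primes m | ~~ (p %| `|b|)%N) p ^ logn p m.

Definition common_part (m : nat) (b : int) : nat :=
  \prod_(p <- primes m | (p %| `|b|)%N) p ^ logn p m.

(* The isomorphism Z/m1Z x Z/m2Z -> Z/mZ, for m = m1 * m2 with m1, m2 > 1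
   coprime; residues are identified with their canonical representatives. *)
Definition psi (m m1 m2 : nat) (t1 : 'Z_m1) (t2 : 'Z_m2) : 'Z_m :=
  let e1 : nat := (m2%:R : 'Z_m1)^-1 in
  let e2 : nat := (m1%:R : 'Z_m2)^-1 in
  (t1 * e1 * m2 + t2 * e2 * m1)%:R.

(* Main.v *)
(* Modulo m1 the coefficient B is invertible, so the recursion runs forward from
   an arbitrary X_0; modulo m2 it is nilpotent and (when d = 1) A is invertible,
   so iterating X_n = A^-1 (B X_(n+1) - F_n) removes the unknown and leaves a
   single solution.  By the Chinese remainder theorem the solutions modulo
   m = m1 m2 correspond to the value of X_0 modulo m1.  In general d divides every
   f_n as soon as a solution exists; dividing by d then reduces to the coprime case
   modulo m' = m / d, and when d <> 1 adding multiples of m' to the terms of one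
   solution gives infinitely many.
   Residues are lifted to integer sequences satisfying the congruences, so that
   passing between moduli never transports terms between the types 'Z_m. *)

Require Import Defs.
From mathcomp Require Import all_boot all_order all_algebra.
From mathcomp Require Import boolp classical_sets functions cardinality.
From mathcomp Require Import zify ring.

Set Implicit Arguments.
Unset Strict Implicit.
Unset Printing Implicit Defensive.

Import GRing.Theory.

Local Open Scope ring_scope.
Local Open Scope card_scope.
Local Open Scope classical_set_scope.

(** * Closed forms when one coefficient is invertible *)

(** Multiplying by the inverse of [B] gives the forward recursion [X n.+1 = C * (A * X n + F n)],
    which the closed form also satisfies; induction identifies the two. The inverse is a witness
    [C], so that the result applies over [Zmod], declared only as a commutative ring. *)
Lemma solutions_of_invertible (R : comPzRingType) (A B C : R) (F : nat -> R)
    (X : nat -> R) : B * C = 1 ->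
  solutions A B F X <->
  forall n, X n = C ^+ n * A ^+ n * X 0%N
                  + \sum_(0 <= s < n) A ^+ s * C ^+ s.+1 * F (n - s.+1)%N.
Proof.
move=> BC.
pose Y n := C ^+ n * A ^+ n * X 0%N
            + \sum_(0 <= s < n) A ^+ s * C ^+ s.+1 * F (n - s.+1)%N.
have YS n : Y n.+1 = C * (A * Y n + F n).
  rewrite /Y big_nat_recl // expr0 expr1 mul1r subn1 /= !mulrDr !mulr_sumr.
  rewrite addrA -addrA [_ + \sum_(_ <= _ < _) _]addrC addrA.
  congr (_ + _ + _); first by rewrite !exprS; ring.
  by apply: eq_bigr => s _; rewrite subSS !exprS; ring.
have BYS n : B * Y n.+1 = A * Y n + F n by rewrite YS mulrA BC mul1r.
split=> [EX n|XY n]; last by rewrite [X n]XY [X n.+1]XY; exact: BYS.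
rewrite -/(Y n); elim: n => [|n IHn].
  by rewrite /Y big_geq // !expr0 !mul1r addr0.
by rewrite YS -IHn -EX mulrA [C * B]mulrC BC mul1r.
Qed.

(** Iterating [X n = C * (B * X n.+1 - F n)] leaves after [j] steps the remainder
    [C ^+ j * B ^+ j * X (n + j)], which vanishes at [j = k]. Conversely, the sum solves the
    equation by telescoping. *)
Lemma solutions_of_nilpotent (R : comPzRingType) (A B C : R) (k : nat)
    (F : nat -> R) (X : nat -> R) : A * C = 1 -> B ^+ k = 0 ->
  solutions A B F X <->
  forall n, X n = - \sum_(0 <= s < k) C ^+ s.+1 * B ^+ s * F (n + s)%N.
Proof.
move=> AC Bk.
pose S j n := \sum_(0 <= s < j) C ^+ s.+1 * B ^+ s * F (n + s)%N.
split=> [EX n|XS n].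
  suff X_iter j : X n = C ^+ j * B ^+ j * X (n + j)%N - S j n.
    by rewrite (X_iter k) Bk mulr0 mul0r add0r.
  elim: j => [|j ->]; first by rewrite /S big_geq // addn0 !expr0 !mul1r subr0.
  have step : C ^+ j.+1 * B ^+ j.+1 * X (n + j.+1)%N =
      C ^+ j * B ^+ j * X (n + j)%N + C ^+ j.+1 * B ^+ j * F (n + j)%N.
    transitivity (C ^+ j.+1 * B ^+ j * (B * X (n + j).+1)).
      by rewrite addnS !exprS; ring.
    rewrite EX; transitivity (C ^+ j * B ^+ j * (A * C) * X (n + j)%N
        + C ^+ j.+1 * B ^+ j * F (n + j)%N); first by rewrite !exprS; ring.
    by rewrite AC mulr1.
  by rewrite step /S big_nat_recr //=; ring.
have -> : X n = - S k n by exact: XS.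
have -> : X n.+1 = - S k n.+1 by exact: XS.
have AS : A * S k n = \sum_(0 <= s < k) C ^+ s * B ^+ s * F (n + s)%N.
  rewrite mulr_sumr; apply: eq_bigr => s _.
  by rewrite exprS !mulrA AC mul1r.
have BS : B * S k n.+1 = \sum_(0 <= s < k) C ^+ s.+1 * B ^+ s.+1 * F (n + s.+1)%N.
  by rewrite mulr_sumr; apply: eq_bigr => s _; rewrite addSnnS [B ^+ s.+1]exprS; ring.
(* As [B ^+ k = 0], the extra term [s = k] is zero; splitting off the term [s = 0] instead leaves
   [F n + B * S k n.+1]. *)
have : \sum_(0 <= s < k.+1) C ^+ s * B ^+ s * F (n + s)%N = A * S k n.
  by rewrite big_nat_recr //= Bk mulr0 mul0r addr0 -AS.
rewrite big_nat_recl // -BS addn0 !expr0 !mul1r => AE.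
by rewrite !mulrN -AE; ring.
Qed.

Lemma nilp_indexP (R : pzRingType) (T : R) (k : nat) :
  T ^+ k = 0 -> T ^+ nilp_index T = 0.
Proof.
move=> Tk; rewrite /nilp_index; case: pselect => [exT|[]].
  by case: ex_minnP => j /andP[_ /eqP].
(* The given [k] may be 0, while [nilp_index] asks for a positive exponent. *)
by exists k.+1; rewrite exprS Tk mulr0 eqxx.
Qed.

(** * Arithmetic of residue classes *)

Lemma natr_Zmod (s n : nat) : (0 < s)%N -> (n%:R : Zmod s) = (n %% s)%N :> nat.
Proof.
case: s => // s _; elim: n => [|n IHn]; first by rewrite mod0n.
rewrite mulrSr.
(* The unit is stored as [1 %% s.+1], which is 0 in the null ring. *)
change ((((n%:R : Zmod s.+1) : nat) + 1 %% s.+1) %% s.+1 = n.+1 %% s.+1)%N.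
by rewrite IHn modnDm addn1.
Qed.

Lemma intr_Zmod_eq0 (s : nat) (x : int) : (0 < s)%N ->
  (x%:~R == 0 :> Zmod s) = (s%:Z %| x)%Z.
Proof.
move=> s_gt0; have natE n : (n%:R == 0 :> Zmod s) = (s %| n)%N.
  by rewrite -(inj_eq val_inj) /= natr_Zmod.
by case: x => n; rewrite dvdzE /= ?NegzE ?rmorphN ?oppr_eq0 natE.
Qed.

Lemma intr_Zp_eq0 (s : nat) (x : int) : (1 < s)%N ->
  (x%:~R == 0 :> 'Z_s) = (s%:Z %| x)%Z.
Proof.
move=> s_gt1; have natE n : (n%:R == 0 :> 'Z_s) = (s %| n)%N.
  by rewrite -(inj_eq val_inj) /= val_Zp_nat.
by case: x => n; rewrite dvdzE /= ?NegzE ?rmorphN ?oppr_eq0 natE.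
Qed.

Lemma natr_Zmod_val (s : nat) (x : Zmod s) : (0 < s)%N ->
  ((x : 'I__) : nat)%:R = x :> Zmod s.
Proof.
move=> s_gt0; apply: val_inj; rewrite /= natr_Zmod // modn_small //.
by case: s x s_gt0 => // s x _; exact: ltn_ord.
Qed.

Lemma unitr_intr_Zp (s : nat) (x : int) : (1 < s)%N -> coprime s `|x| ->
  (x%:~R : 'Z_s) \is a GRing.unit.
Proof.
by move=> s_gt1; case: x => n cop; rewrite ?NegzE ?rmorphN ?unitrN unitZpE.
Qed.

(** * Integer lifts of solutions *)

Definition int_solution (m : nat) (a b : int) (f : nat -> int) (x : nat -> int) :=
  forall n, (m%:Z %| b * x n.+1 - a * x n - f n)%Z.

(** Only the kernel of the map from [int] to [R] enters, so one statement serves both [Zmod m] and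
    ['Z_m]. *)
Lemma solutions_intr (R : pzRingType) (m : nat) (a b : int) (f x : nat -> int) :
  (forall y : int, (y%:~R == 0 :> R) = (m%:Z %| y)%Z) ->
  solutions (a%:~R : R) b%:~R (fun n => (f n)%:~R) (fun n => (x n)%:~R) <->
  int_solution m a b f x.
Proof.
move=> R0; have eqE n : (b * x n.+1 - a * x n - f n)%:~R =
    b%:~R * (x n.+1)%:~R - (a%:~R * (x n)%:~R + (f n)%:~R) :> R.
  by rewrite !rmorphB !rmorphM /= opprD addrA.
split=> E n; first by rewrite -R0 eqE subr_eq0 E.
by apply/eqP; rewrite -subr_eq0 -eqE R0.
Qed.

Lemma invertible_Zmod (m : nat) (a : int) : (0 < m)%N -> coprime m `|a| ->
  exists C : Zmod m, a%:~R * C = 1.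
Proof.
move=> m_gt0 cop; have /coprimezP[[u v] /= uv] : coprimez a m.
  by rewrite coprimezE coprime_sym.
exists u%:~R; apply/eqP; rewrite -subr_eq0 -[1]/(1%:~R) -rmorphM -rmorphB /=.
rewrite intr_Zmod_eq0 // -uv; apply/dvdzP; exists (- v); ring.
Qed.

(** * Splitting into a modulus where b is invertible and one where it is nilpotent *)

Section Splitting.
Variables (m1 m2 k : nat) (a b : int) (f : nat -> int).
Hypotheses (m1_gt0 : (0 < m1)%N) (m2_gt0 : (0 < m2)%N).
Hypotheses (cop_m1b : coprime m1 `|b|) (cop_m2a : coprime m2 `|a|).
Hypothesis m2_dvd : (m2 %| `|b| ^ k)%N.

Lemma coprime_split : coprime m1 m2.
Proof. exact: coprime_dvdr m2_dvd (coprimeXr _ cop_m1b). Qed.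

Lemma int_solution_split x : int_solution (m1 * m2) a b f x <->
  int_solution m1 a b f x /\ int_solution m2 a b f x.
Proof.
have E y : ((m1 * m2)%N%:Z %| y)%Z = (m1%:Z %| y)%Z && (m2%:Z %| y)%Z.
  by rewrite PoszM Gauss_dvdz // coprimezE coprime_split.
split=> [S|[S1 S2] n]; last by rewrite E S1 S2.
by split=> n; have := S n; rewrite E => /andP[].
Qed.

Lemma nilpotent_Zmod : (b%:~R : Zmod m2) ^+ k = 0.
Proof.
by apply/eqP; rewrite -rmorphXn /= intr_Zmod_eq0 // dvdzE abszX.
Qed.

(** The closed forms modulo [m1], started at [t], and modulo [m2] are glued term by term by the
    Chinese remainder theorem. Computing in [Zmod] includes the cases where a factor is 1. *)
Lemma int_solution_exists (t : int) :
  exists2 x, (m1%:Z %| x 0%N - t)%Z & int_solution (m1 * m2) a b f x.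
Proof.
have [C1 BC] := invertible_Zmod m1_gt0 cop_m1b.
have [C2 AC] := invertible_Zmod m2_gt0 cop_m2a.
pose X1 n : Zmod m1 := C1 ^+ n * a%:~R ^+ n * t%:~R
  + \sum_(0 <= s < n) a%:~R ^+ s * C1 ^+ s.+1 * (f (n - s.+1)%N)%:~R.
pose X2 n : Zmod m2 :=
  - \sum_(0 <= s < k) C2 ^+ s.+1 * b%:~R ^+ s * (f (n + s)%N)%:~R.
have X10 : X1 0%N = t%:~R by rewrite /X1 big_geq // !expr0 !mul1r addr0.
have E1 : solutions a%:~R b%:~R (fun n => (f n)%:~R) X1.
  by apply/(solutions_of_invertible _ _ _ BC) => n; rewrite X10.
have E2 : solutions a%:~R b%:~R (fun n => (f n)%:~R) X2.
  exact/(solutions_of_nilpotent _ _ AC nilpotent_Zmod).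
have cop12 : coprimez m1 m2 by rewrite coprimezE coprime_split.
pose x n := zchinese m1 m2 (X1 n : 'I__)%:Z (X2 n : 'I__)%:Z.
have xX1 : (fun n => (x n)%:~R) = X1.
  apply: funext => n; rewrite -[RHS]natr_Zmod_val //; apply/eqP.
  rewrite -subr_eq0 -[_%:R]/(_%:Z%:~R) -rmorphB /= intr_Zmod_eq0 //.
  by rewrite -eqz_mod_dvd; apply/eqP/zchinese_modl.
have xX2 : (fun n => (x n)%:~R) = X2.
  apply: funext => n; rewrite -[RHS]natr_Zmod_val //; apply/eqP.
  rewrite -subr_eq0 -[_%:R]/(_%:Z%:~R) -rmorphB /= intr_Zmod_eq0 //.
  by rewrite -eqz_mod_dvd; apply/eqP/zchinese_modr.
exists x; first by rewrite -intr_Zmod_eq0 // rmorphB /= subr_eq0 -X10 -xX1.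
apply/int_solution_split; split.
- by apply/(solutions_intr _ _ _ _ (fun y => intr_Zmod_eq0 y m1_gt0)); rewrite xX1.
- by apply/(solutions_intr _ _ _ _ (fun y => intr_Zmod_eq0 y m2_gt0)); rewrite xX2.
Qed.

(** Modulo [m1] the closed form depends only on the initial value; modulo [m2] it involves no free
    value at all. *)
Lemma int_solution_unique x y :
  int_solution (m1 * m2) a b f x -> int_solution (m1 * m2) a b f y ->
  (m1%:Z %| x 0%N - y 0%N)%Z -> forall n, ((m1 * m2)%N%:Z %| x n - y n)%Z.
Proof.
have [C1 BC] := invertible_Zmod m1_gt0 cop_m1b.
have [C2 AC] := invertible_Zmod m2_gt0 cop_m2a.
move=> /int_solution_split[x1 x2] /int_solution_split[y1 y2] xy0 n.
rewrite PoszM Gauss_dvdz ?coprimezE ?coprime_split //; apply/andP; split.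
  have toZ := solutions_intr _ _ _ _ (fun y => intr_Zmod_eq0 y m1_gt0).
  move/toZ/(solutions_of_invertible _ _ _ BC): x1 => x1.
  move/toZ/(solutions_of_invertible _ _ _ BC): y1 => y1.
  move: xy0; rewrite -!intr_Zmod_eq0 // !rmorphB !subr_eq0 /= => /eqP xy0.
  by rewrite x1 y1 xy0.
have toZ := solutions_intr _ _ _ _ (fun y => intr_Zmod_eq0 y m2_gt0).
move/toZ/(solutions_of_nilpotent _ _ AC nilpotent_Zmod): x2 => x2.
move/toZ/(solutions_of_nilpotent _ _ AC nilpotent_Zmod): y2 => y2.
by rewrite -intr_Zmod_eq0 // rmorphB subr_eq0 /= x2 y2.
Qed.

End Splitting.

(** * The two parts of m determined by the primes of b *)

Lemma coprime_partM (m : nat) (b : int) : (0 < m)%N ->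
  (coprime_part m b * common_part m b)%N = m.
Proof.
move=> m_gt0; rewrite [RHS](prod_prime_decomp m_gt0) prime_decompE big_map /=.
by rewrite [RHS](bigID (fun p => ~~ (p %| `|b|)%N)) /=; congr (_ * _)%N;
  apply: eq_bigl => p; rewrite negbK.
Qed.

Lemma coprime_coprime_part (m : nat) (b : int) : coprime (coprime_part m b) `|b|.
Proof.
rewrite /coprime_part big_seq_cond; apply: (big_ind (coprime^~ `|b|%N)).
- exact: coprime1n.
- by move=> x y cx cy; rewrite coprimeMl cx.
- move=> p /andP[]; rewrite mem_primes => /and3P[p_pr _ _] pNb.
  by rewrite coprimeXl // prime_coprime.
Qed.

(** This is the nilpotency of b modulo [common_part m b], expressed in [nat]. *)
Lemma common_part_dvd (m : nat) (b : int) :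
  exists k, (common_part m b %| `|b| ^ k)%N.
Proof.
rewrite /common_part; apply: (big_ind (fun x => exists k, (x %| `|b| ^ k)%N)).
- by exists 0%N.
- by move=> x y [i xb] [j yb]; exists (i + j)%N; rewrite expnD dvdn_mul.
- by move=> p pb; exists (logn p m); rewrite dvdn_exp2r.
Qed.

(** A common divisor of [g] and b divides a, b and m, hence is 1. But [g] also divides a power of b,
    so [g = 1]. *)
Lemma coprime_common_part (m : nat) (a b : int) : (0 < m)%N ->
  gcd_abm a b m = 1%N -> coprime (common_part m b) `|a|.
Proof.
move=> m_gt0 d1; have [k m2_dvd] := common_part_dvd m b.
set g := gcdn (common_part m b) `|a|.
have gb : coprime g `|b|.
  rewrite /coprime -dvdn1 -d1 /gcd_abm !dvdn_gcd dvdn_gcdr andbT.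
  rewrite (dvdn_trans (dvdn_gcdl g _)) ?dvdn_gcdr //=.
  rewrite (dvdn_trans (dvdn_gcdl g _)) // (dvdn_trans (dvdn_gcdl _ _)) //.
  by rewrite -{2}(coprime_partM b m_gt0) dvdn_mull.
have gk : (g %| `|b| ^ k)%N by exact: dvdn_trans (dvdn_gcdl _ _) m2_dvd.
by have := coprime_dvdr gk (coprimeXr k gb); rewrite /coprime gcdnn.
Qed.

(** * The isomorphism psi and formulas over ['Z_m] *)

Lemma eqr_nat_Zp (s x y : nat) : (1 < s)%N ->
  (x%:R == y%:R :> 'Z_s) = (x == y %[mod s]).
Proof. by move=> s_gt1; rewrite -(inj_eq val_inj) /= !val_Zp_nat. Qed.

(** The representative [N] in [psi] reduces to [t1] and [t2], because each summand vanishes modulo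
    one factor and [e1], [e2] cancel the cofactors; the Chinese remainder theorem then makes the two
    reductions characterise [x]. *)
Lemma psiP (m m1 m2 : nat) (t1 : 'Z_m1) (t2 : 'Z_m2) (x : 'Z_m) :
  (1 < m1)%N -> (1 < m2)%N -> coprime m1 m2 -> m = (m1 * m2)%N ->
  x = psi m t1 t2 <-> (x : nat)%:R = t1 /\ (x : nat)%:R = t2.
Proof.
move=> m1_gt1 m2_gt1 cop12 mE.
have m_gt1 : (1 < m)%N by rewrite mE; lia.
have mod_m u v : (u == v %[mod m]) = (u == v %[mod m1]) && (u == v %[mod m2]).
  by rewrite mE chinese_remainder.
rewrite /psi; set e1 := nat_of_ord _^-1; set e2 := nat_of_ord _^-1.
set N := (_ + _)%N.
have N1 : N%:R = t1.
  rewrite /N natrD !natrM pchar_Zp // mulr0 addr0 !natr_Zp.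
  by rewrite mulrVK // unitZpE.
have N2 : N%:R = t2.
  rewrite /N natrD !natrM pchar_Zp // mulr0 add0r !natr_Zp.
  by rewrite mulrVK // unitZpE // coprime_sym.
rewrite -{1}[x]natr_Zp -N1 -N2; split=> [/eqP|[/eqP x1 /eqP x2]].
  rewrite eqr_nat_Zp // mod_m -!eqr_nat_Zp //.
  by case/andP=> /eqP-> /eqP->.
apply/eqP; rewrite eqr_nat_Zp // mod_m -!eqr_nat_Zp //.
by rewrite x1 x2.
Qed.

Lemma solutions_of_unit (R : comUnitRingType) (A B : R) (F X : nat -> R) :
  B \is a GRing.unit ->
  solutions A B F X <->
  forall n, X n = B ^- n * A ^+ n * X 0%N
                  + \sum_(0 <= s < n) A ^+ s * B ^- s.+1 * F (n - s.+1)%N.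
Proof.
move=> Bu; rewrite (solutions_of_invertible _ _ _ (divrr Bu)).
split=> XE n; rewrite {1}XE exprVn; congr (_ + _);
  by apply: eq_bigr => s _; rewrite exprVn.
Qed.

Lemma solutions_of_unit_nilpotent (R : comUnitRingType) (A B : R) (k : nat)
    (F X : nat -> R) : A \is a GRing.unit -> B ^+ k = 0 ->
  solutions A B F X <->
  forall n, X n = - \sum_(0 <= s < nilp_index B) A ^- s.+1 * B ^+ s * F (n + s)%N.
Proof.
move=> Au /nilp_indexP Bk; rewrite (solutions_of_nilpotent _ _ (divrr Au) Bk).
by split=> XE n; rewrite {1}XE; congr (- _); apply: eq_bigr => s _; rewrite exprVn.
Qed.

Lemma solutions_Zp (m : nat) (a b : int) (f : nat -> int) (X : nat -> 'Z_m) :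
  (1 < m)%N ->
  solutions (a%:~R : 'Z_m) b%:~R (fun n => (f n)%:~R) X <->
  int_solution m a b f (fun n => (X n : nat)%:Z).
Proof.
move=> m_gt1; rewrite -(solutions_intr _ _ _ _ (fun y => intr_Zp_eq0 y m_gt1)).
suff -> : (fun n => ((X n : nat)%:Z)%:~R) = X by [].
by apply: funext => n; exact: natr_Zp.
Qed.

Lemma int_solution_eqmod (m : nat) (a b : int) (f x y : nat -> int) :
  (forall n, (m%:Z %| x n - y n)%Z) ->
  int_solution m a b f x -> int_solution m a b f y.
Proof.
move=> xy Sx n; have -> : b * y n.+1 - a * y n - f n =
    (b * x n.+1 - a * x n - f n) - b * (x n.+1 - y n.+1) + a * (x n - y n) by ring.
by apply: rpredD; [apply: rpredB => //|]; apply: dvdz_mull.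
Qed.

Lemma int_solution_scale (d m : nat) (a b : int) (f x : nat -> int) : (0 < d)%N ->
  int_solution (d * m) (d%:Z * a) (d%:Z * b) (fun n => d%:Z * f n) x <->
  int_solution m a b f x.
Proof.
move=> d_gt0; suff E n : ((d * m)%N%:Z %|
    d%:Z * b * x n.+1 - d%:Z * a * x n - d%:Z * f n)%Z =
    (m%:Z %| b * x n.+1 - a * x n - f n)%Z.
  by split=> S n; have := S n; rewrite E.
rewrite -!mulrA -!mulrBr PoszM dvdz_mul2l //; lia.
Qed.

(** * Counting solutions when d = 1 *)

(** Choose for each [t] a solution [g t] whose initial term is [t] modulo [m1]. By uniqueness [g]
    maps the residues below [m1] onto the solution set, and it is injective there since the initial
    term recovers [t]. *)
Lemma card_solutions_Zp (m : nat) (a b : int) (f : nat -> int) :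
  (1 < m)%N -> gcd_abm a b m = 1%N ->
  solutions (a%:~R : 'Z_m) b%:~R (fun n => (f n)%:~R) #= `I_(coprime_part m b).
Proof.
move=> m_gt1 d1; have m_gt0 := ltnW m_gt1.
have mE := coprime_partM b m_gt0; have := coprime_coprime_part m b.
have := coprime_common_part m_gt0 d1; have [k] := common_part_dvd m b.
have : (0 < common_part m b)%N by move: m_gt0; rewrite -{1}mE muln_gt0 => /andP[].
have : (0 < coprime_part m b)%N by move: m_gt0; rewrite -{1}mE muln_gt0 => /andP[].
move: (coprime_part m b) (common_part m b) mE => m1 m2 mE.
move=> m1_gt0 m2_gt0 m2_dvd cop_m2a cop_m1b.
set E := solutions _ _ _.
have ex (t : nat) : exists X : nat -> 'Z_m, E X /\ (m1%:Z %| (X 0%N : nat)%:Z - t%:Z)%Z.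
  have [x x0 Sx] := int_solution_exists f m1_gt0 m2_gt0 cop_m1b cop_m2a m2_dvd t.
  pose X n : 'Z_m := (x n)%:~R.
  have Xx n : (m%:Z %| x n - (X n : nat)%:Z)%Z.
    by rewrite -intr_Zp_eq0 // rmorphB /= subr_eq0 [X in _ == X]natr_Zp.
  exists X; split.
    by apply/solutions_Zp => //; apply: (int_solution_eqmod Xx); rewrite -mE.
  have -> : (X 0%N : nat)%:Z - t%:Z = (x 0%N - t%:Z) - (x 0%N - (X 0%N : nat)%:Z) by ring.
  by rewrite rpredB // (dvdz_trans _ (Xx 0%N)) // -mE PoszM dvdz_mulr.
have [g /= gP] := choice ex.
have uniqZ x y := @int_solution_unique _ _ _ _ _ f
  m1_gt0 m2_gt0 cop_m1b cop_m2a m2_dvd x y.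
rewrite mE in uniqZ.
have uniqE X Y : E X -> E Y -> (m1%:Z %| (X 0%N : nat)%:Z - (Y 0%N : nat)%:Z)%Z -> X = Y.
  move=> /(solutions_Zp _ _ _ _ m_gt1) SX /(solutions_Zp _ _ _ _ m_gt1) SY XY0.
  apply: funext => n; apply/eqP.
  rewrite -[X n]natr_Zp -[Y n]natr_Zp -subr_eq0.
  rewrite -[_%:R]/(_%:Z%:~R) -[Y in _ - Y]/(_%:Z%:~R) -rmorphB intr_Zp_eq0 //.
  exact: (uniqZ _ _ SX SY XY0).
have -> : E = g @` `I_m1.
  apply/seteqP; split=> [X EX|X [t _ <-]]; last by case: (gP t).
  exists ((X 0%N : nat) %% m1)%N; first by rewrite /= ltn_mod.
  have [Eg g0] := gP ((X 0%N : nat) %% m1)%N; apply: uniqE => //.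
  by move: g0; rewrite -!eqz_mod_dvd => /eqP->; rewrite -modz_nat modz_mod.
apply: inj_card_eq => s t; rewrite !inE /= => s_lt t_lt gst.
have [_ gs] := gP s; have [_ gt] := gP t; rewrite gst in gs.
have : (m1%:Z %| s%:Z - t%:Z)%Z.
  have -> : s%:Z - t%:Z = ((g t 0%N : nat)%:Z - t%:Z) - ((g t 0%N : nat)%:Z - s%:Z) by ring.
  by rewrite rpredB.
by rewrite -eqz_mod_dvd !modz_nat eqz_nat !modn_small // => /eqP.
Qed.

(** * Division by d: existence and infinitude *)

Lemma gcd_abm_reduce (m : nat) (a b : int) : (0 < m)%N ->
  let d := gcd_abm a b m in
  exists a' b' m', [/\ (0 < d)%N /\ (0 < m')%N, a = d%:Z * a', b = d%:Z * b',
                       m = (d * m')%N & gcd_abm a' b' m' = 1%N].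
Proof.
move=> m_gt0 d; have d_gt0 : (0 < d)%N by rewrite gcdn_gt0 m_gt0 orbT.
have /dvdzP[a' aE] : (d%:Z %| a)%Z.
  by rewrite dvdzE; apply: dvdn_trans (dvdn_gcdl _ _) (dvdn_gcdl _ _).
have /dvdzP[b' bE] : (d%:Z %| b)%Z.
  by rewrite dvdzE; apply: dvdn_trans (dvdn_gcdl _ _) (dvdn_gcdr _ _).
have /dvdnP[m' mE] : (d %| m)%N by exact: dvdn_gcdr.
exists a', b', m'; split=> //; rewrite 1?mulrC 1?mulnC //.
  by split=> //; move: m_gt0; rewrite mE muln_gt0 => /andP[].
apply/eqP; rewrite -(eqn_pmul2l d_gt0) muln1; apply/eqP.
rewrite [in RHS]/d /gcd_abm aE bE mE !abszM /=.
by rewrite -!muln_gcdl mulnC.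
Qed.

Lemma int_solution_dvd (d m : nat) (a b : int) (f x : nat -> int) :
  int_solution (d * m) (d%:Z * a) (d%:Z * b) f x -> forall n, (d%:Z %| f n)%Z.
Proof.
move=> S n; have -> : f n = d%:Z * (b * x n.+1 - a * x n) -
  (d%:Z * b * x n.+1 - d%:Z * a * x n - f n) by ring.
apply: rpredB; first by rewrite dvdz_mulr.
by apply: dvdz_trans (S n); rewrite PoszM dvdz_mulr.
Qed.

(** Necessity holds because d divides a, b and the modulus. For sufficiency, the equation divided by
    d has coprime data modulo [m'], possibly 1, and an integer lift of a solution there solves the
    original one. *)
Lemma solutions_Zp_nonempty (m : nat) (a b : int) (f : nat -> int) :
  (1 < m)%N ->
  solutions (a%:~R : 'Z_m) b%:~R (fun n => (f n)%:~R) !=set0 <->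
  forall n, ((gcd_abm a b m)%:Z %| f n)%Z.
Proof.
move=> m_gt1; have m_gt0 := ltnW m_gt1.
have := gcd_abm_reduce a b m_gt0; set d := gcd_abm a b m => /=.
move=> [a' [b' [m' [[d_gt0 m'_gt0] aE bE mE d1]]]]; split=> [[X]|df].
  move=> /(solutions_Zp _ _ _ _ m_gt1).
  (* Stated for integer sequences, so that rewriting [m] leaves the type of [X] alone. *)
  have dvd x : int_solution m a b f x -> forall n, (d%:Z %| f n)%Z.
    by rewrite {1}mE aE bE; exact: int_solution_dvd.
  exact: dvd.
pose f' n := (f n %/ d%:Z)%Z.
have fE n : f n = d%:Z * f' n by rewrite mulrC divzK.
have mE' := coprime_partM b' m'_gt0; have cop_m1b := coprime_coprime_part m' b'.
have cop_m2a := coprime_common_part m'_gt0 d1.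
have [k m2_dvd] := common_part_dvd m' b'.
have /andP[m1_gt0 m2_gt0] : (0 < coprime_part m' b')%N && (0 < common_part m' b')%N.
  by rewrite -muln_gt0 mE'.
have [x _] := int_solution_exists f' m1_gt0 m2_gt0 cop_m1b cop_m2a m2_dvd 0.
rewrite mE' => Sx; exists (fun n => (x n)%:~R).
apply/(solutions_intr _ _ _ _ (fun y => intr_Zp_eq0 y m_gt1)).
by rewrite mE aE bE (funext fE); apply/int_solution_scale.
Qed.

Lemma solutions_add_annihilated (R : pzRingType) (A B u : R) (F X : nat -> R)
    (c : nat -> nat) : A * u = 0 -> B * u = 0 ->
  solutions A B F X -> solutions A B F (fun n => X n + u *+ c n).
Proof.
move=> Au Bu EX n.
by rewrite !mulrDr !mulrnAr Au Bu !mul0rn !addr0; exact: EX.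
Qed.

(** The class [u] of [m'] is nonzero as [0 < m' < m], and a, b annihilate it, being multiples of d.
    Adding [u] to the term of index [k] alone gives pairwise distinct solutions [g k]. *)
Lemma solutions_Zp_infinite (m : nat) (a b : int) (f : nat -> int) :
  (1 < m)%N -> gcd_abm a b m <> 1%N ->
  let E := solutions (a%:~R : 'Z_m) b%:~R (fun n => (f n)%:~R) in
  E !=set0 -> infinite_set E.
Proof.
move=> m_gt1 + E [X EX]; have := gcd_abm_reduce a b (ltnW m_gt1).
set d := gcd_abm a b m => /=; move=> [a' [b' [m' [[d_gt0 m'_gt0] aE bE mE _]]]] dN1.
pose u : 'Z_m := m'%:R.
have u_neq0 : u != 0.
  rewrite -[u]/(m'%:Z%:~R) intr_Zp_eq0 // dvdzE /= gtnNdvd // mE; nia.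
have au : a%:~R * u = 0.
  apply/eqP; rewrite -[u]/(m'%:Z%:~R) -rmorphM /= intr_Zp_eq0 // aE mulrAC.
  by rewrite -PoszM -mE dvdz_mulr.
have bu : b%:~R * u = 0.
  apply/eqP; rewrite -[u]/(m'%:Z%:~R) -rmorphM /= intr_Zp_eq0 // bE mulrAC.
  by rewrite -PoszM -mE dvdz_mulr.
pose g (k n : nat) := X n + u *+ (n == k).
have Eg k : E (g k) by exact: solutions_add_annihilated.
have g_inj : injective g.
  (* At index [k], [g k] has the extra summand [u], and [g l] has none unless [l = k]. *)
  move=> k l gkl; apply/eqP; have /addrI := congr1 (@^~ k) gkl.
  by rewrite eqxx; case: eqP => // _ /eqP; rewrite mulr0n mulr1n (negPf u_neq0).
move=> finE; apply: infinite_nat.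
have -> : [set: nat] = g @^-1` E by apply/seteqP; split=> // k _; exact: Eg.
by apply: finite_preimage => // k l _ _; exact: g_inj.
Qed.

(** * The three cases in terms of d and the f_n *)

Theorem theorem3p2 (m : nat) (m_ge2 : (2 <= m)%N) (a b : int) (f : nat -> int) :
  let A : 'Z_m := a%:~R in
  let B : 'Z_m := b%:~R in
  let F : nat -> 'Z_m := fun n => (f n)%:~R in
  let E : set (nat -> 'Z_m) := solutions A B F in
  let d : nat := gcd_abm a b m in
  let m1 : nat := coprime_part m b in
  let m2 : nat := common_part m b in
  let A1 : 'Z_m1 := a%:~R in
  let B1 : 'Z_m1 := b%:~R in
  let F1 : nat -> 'Z_m1 := fun n => (f n)%:~R in
  let A2 : 'Z_m2 := a%:~R in
  let B2 : 'Z_m2 := b%:~R in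
  let F2 : nat -> 'Z_m2 := fun n => (f n)%:~R in
  let m' : nat := (m %/ d)%N in
  let A' : Zmod m' := (a %/ d%:Z)%Z%:~R in
  let B' : Zmod m' := (b %/ d%:Z)%Z%:~R in
  let F' : nat -> Zmod m' := fun n => (f n %/ d%:Z)%Z%:~R in
  let E' : set (nat -> Zmod m') := solutions A' B' F' in
  [/\ (* 1 *)
      ((finite_set E /\ E !=set0) <-> d = 1%N) /\
      (d = 1%N ->
       [/\ E #= `I_m1,
           (* (a) *)
           m2 = 1%N ->
           forall X : nat -> 'Z_m, E X <->
             exists X0 : 'Z_m, X 0%N = X0 /\
               forall n : nat, (0 < n)%N ->
                 X n = B ^- n * A ^+ n * X0
                       + \sum_(0 <= s < n) A ^+ s * B ^- s.+1 * F (n - s.+1)%N,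
           (* (b) *)
           m1 = 1%N ->
           forall X : nat -> 'Z_m, E X <->
             forall n : nat,
               X n = - \sum_(0 <= s < nilp_index B)
                         A ^- s.+1 * B ^+ s * F (n + s)%N
         & (* (c) *)
           m1 <> 1%N -> m2 <> 1%N ->
           forall X : nat -> 'Z_m, E X <->
             exists X10 : 'Z_m1,
               X 0%N = psi m X10
                 (- \sum_(0 <= s < nilp_index B2)
                      A2 ^- s.+1 * B2 ^+ s * F2 s) /\
               forall n : nat, (0 < n)%N ->
                 X n = psi m
                   (B1 ^- n * A1 ^+ n * X10
                    + \sum_(0 <= s < n)
                        A1 ^+ s * B1 ^- s.+1 * F1 (n - s.+1)%N)
                   (- \sum_(0 <= s < nilp_index B2)
                        A2 ^- s.+1 * B2 ^+ s * F2 (n + s)%N)]),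
      (* 2 *)
      (infinite_set E <-> (d <> 1%N /\ forall n : nat, (d%:Z %| f n)%Z)) /\
      (d <> 1%N -> (forall n : nat, (d%:Z %| f n)%Z) ->
       (forall X : nat -> 'Z_m, E X <->
          exists (x' : nat -> int) (alpha : nat -> 'I_d),
            E' (fun n => (x' n)%:~R) /\
            forall n : nat, X n = (x' n + (alpha n)%:Z * m'%:Z)%:~R) /\
       (forall X : nat -> 'Z_m, E X ->
          exists! p : (nat -> 'I_m') * (nat -> 'I_d),
            E' (fun n => (p.1 n)%:R) /\
            forall n : nat, X n = (p.1 n + p.2 n * m')%N%:R))
    & (* 3 *)
      E = set0 <-> exists n : nat, ~~ (d%:Z %| f n)%Z].
Proof.
move=> A B F E d m1 m2 A1 B1 F1 A2 B2 F2 m' A' B' F' E'.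
have m_gt0 : (0 < m)%N := ltnW m_ge2.
have nonempty : E !=set0 <-> forall n, (d%:Z %| f n)%Z.
  exact: solutions_Zp_nonempty.
have inf : d <> 1%N -> E !=set0 -> infinite_set E.
  exact: solutions_Zp_infinite.
have card1 : d = 1%N -> E #= `I_m1 by exact: card_solutions_Zp.
have fin1 : d = 1%N -> finite_set E by move/card1 => cE; apply/finite_setP; exists m1.
have mE : (m1 * m2)%N = m by exact: coprime_partM.
have cop_m1b : coprime m1 `|b| by exact: coprime_coprime_part.
have [k m2_dvd] : exists k, (m2 %| `|b| ^ k)%N by exact: common_part_dvd.
have m12_gt0 : (0 < m1)%N && (0 < m2)%N by rewrite -muln_gt0 mE.
have [m1_gt0 m2_gt0] := andP m12_gt0.
split.
- split.
    split=> [[finE neE]|d1]; last first.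
      by split; [exact: fin1|apply/nonempty => n; rewrite d1 dvdzE dvd1n].
    (* If [d] were not 1, a nonempty solution set would be infinite. *)
    by apply: contrapT => dN1; exact: inf dN1 neE finE.
  move=> d1; have cop_m2a : coprime m2 `|a| by exact: coprime_common_part.
  split=> [|m2_1 X|m1_1 X|m1_neq1 m2_neq1 X]; first exact: card1.
  + have Bu : B \is a GRing.unit.
      by apply: unitr_intr_Zp; rewrite // -mE m2_1 muln1.
    rewrite /E (solutions_of_unit _ _ _ Bu); split=> [XE|[X0 [<- XE]] n].
      by exists (X 0%N); split=> // n _; exact: XE.
    case: n => [|n]; last exact: XE.
    (* The formula is only assumed for positive [n]; at 0 the sum is empty and it becomes
       trivial. *)
    by rewrite big_geq // expr0 invr1 !mul1r addr0.
  + have m2E : m2 = m by rewrite -mE m1_1 mul1n.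
    have Au : A \is a GRing.unit by apply: unitr_intr_Zp; rewrite // -m2E.
    have Bk : B ^+ k = 0.
      by apply/eqP; rewrite -rmorphXn /= intr_Zp_eq0 // dvdzE abszX -m2E.
    exact: solutions_of_unit_nilpotent Au Bk.
  + have m1_gt1 : (1 < m1)%N by lia.
    have m2_gt1 : (1 < m2)%N by lia.
    have B1u : B1 \is a GRing.unit by exact: unitr_intr_Zp.
    have A2u : A2 \is a GRing.unit by exact: unitr_intr_Zp.
    have B2k : B2 ^+ k = 0.
      by apply/eqP; rewrite -rmorphXn /= intr_Zp_eq0 // dvdzE abszX.
    have cop12 := coprime_split cop_m1b m2_dvd.
    pose X1 n : 'Z_m1 := (X n : nat)%:R; pose X2 n : 'Z_m2 := (X n : nat)%:R.
    have psiE n t1 t2 : X n = psi m t1 t2 <-> X1 n = t1 /\ X2 n = t2.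
      exact: psiP.
    have split_sol x := int_solution_split a f cop_m1b m2_dvd x.
    rewrite mE in split_sol.
    (* Both sides are read on the canonical integer lift of [X], where the modulus splits. *)
    have EE : E X <-> solutions A1 B1 F1 X1 /\ solutions A2 B2 F2 X2.
      rewrite /E solutions_Zp // split_sol.
      rewrite -(solutions_intr _ _ _ _ (fun y => intr_Zp_eq0 y m1_gt1)).
      by rewrite -(solutions_intr _ _ _ _ (fun y => intr_Zp_eq0 y m2_gt1)).
    rewrite EE (solutions_of_unit _ _ _ B1u).
    rewrite (solutions_of_unit_nilpotent _ _ A2u B2k).
    split=> [[X1E X2E]|[X10 [/psiE[X10E X20E] XE]]].
      exists (X1 0%N); split; first by apply/psiE; split=> //; exact: X2E.
      by move=> n _; apply/psiE; split; [exact: X1E|exact: X2E].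
    split=> [] [|n].
    * by rewrite big_geq // expr0 invr1 !mul1r addr0.
    * by have /psiE[-> _] := XE n.+1 isT; rewrite X10E.
    * exact: X20E.
    * by have /psiE[] := XE n.+1 isT.
- have inf_iff : infinite_set E <-> d <> 1%N /\ forall n, (d%:Z %| f n)%Z.
    split=> [infE|[dN1 /nonempty neE]]; last exact: inf.
    split=> [/fin1 //|]; apply/nonempty; exact: infinite_setN0.
  split=> // dN1 df.
  have [a' [b' [mq [[d_gt0 mq_gt0] aE bE mE' _]]]] := gcd_abm_reduce a b m_gt0.
  rewrite -/d in d_gt0 aE bE mE'.
  have m'E : mq = m' by rewrite /m' mE' mulKn.
  have a'E : a' = (a %/ d%:Z)%Z by rewrite aE mulKz //; lia.
  have b'E : b' = (b %/ d%:Z)%Z by rewrite bE mulKz //; lia.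
  rewrite {}m'E in mq_gt0 mE'.
  pose f' n := (f n %/ d%:Z)%Z.
  have fE n : f n = d%:Z * f' n by rewrite mulrC divzK.
  (* An integer sequence solves the equation modulo [m] exactly when it solves the one divided by
     [d] modulo [m']. *)
  have scale x : int_solution m a b f x <-> E' (fun n => (x n)%:~R).
    apply: (iff_trans _ (iff_sym (solutions_intr (a %/ d%:Z)%Z (b %/ d%:Z)%Z f' x
      (fun y => intr_Zmod_eq0 y mq_gt0)))).
    rewrite -a'E -b'E -(int_solution_scale m' a' b' f' x d_gt0).
    by rewrite -aE -bE -mE' -(funext fE).
  have EX_int X x : (forall n, X n = (x n)%:~R) -> E X <-> E' (fun n => (x n)%:~R).
    move=> Xx; rewrite -scale /E (funext Xx).
    exact: solutions_intr (fun y => intr_Zp_eq0 y m_ge2).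
  (* Multiples of [m'] vanish in [Zmod m'], which is why the [alpha n] are arbitrary. *)
  have shift (x alpha : nat -> int) :
      (fun n => (x n + alpha n * m'%:Z)%:~R) = (fun n => (x n)%:~R) :> (nat -> Zmod m').
    apply: funext => n; apply/eqP; rewrite -subr_eq0 -rmorphB /= intr_Zmod_eq0 //.
    by rewrite addrC addKr dvdz_mull.
  have uniq X : E X -> exists! p : (nat -> 'I_m') * (nat -> 'I_d),
      E' (fun n => (p.1 n)%:R) /\ forall n, X n = (p.1 n + p.2 n * m')%N%:R.
    move=> EX.
    (* The pair consists of the remainder and the quotient of the canonical representative of [X n]
       by [m']; the quotient is below [d] as [m = d * m']. *)
    have quo_lt n : ((X n : nat) %/ m' < d)%N.
      rewrite ltn_divLR // -mE'; have := ltn_ord (X n).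
      by rewrite [X in (_ < X)%N -> _]Zp_cast.
    have mod_lt n : ((X n : nat) %% m' < m')%N by rewrite ltn_mod.
    exists (fun n => Ordinal (mod_lt n), fun n => Ordinal (quo_lt n)); split=> /=.
      have XE n : X n = ((X n : nat) %% m' + (X n : nat) %/ m' * m')%N%:R.
        by rewrite addnC -divn_eq natr_Zp.
      split=> //; have : E' (fun n => (((X n : nat) %% m')%N%:Z
          + ((X n : nat) %/ m')%N%:Z * m'%:Z)%:~R).
        by apply/(EX_int X) => // n; rewrite -PoszM -PoszD; exact: XE.
      by rewrite shift.
    move=> [u v] /= [_ XE].
    (* The bounds on [u] and [v] keep this number below [d * m' = m], so it is the canonical
       representative itself and Euclidean division determines [u n] and [v n]. *)
    have Xval n : X n = (v n * m' + u n)%N :> nat.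
      rewrite XE val_Zp_nat // modn_small 1?addnC // mE'.
      apply: (@leq_trans (v n * m' + m')%N); first by rewrite ltn_add2l.
      by rewrite -mulSnr leq_mul2r ltn_ord orbT.
    congr (_, _); apply: funext => n; apply: val_inj; rewrite /= Xval.
      by rewrite modnMDl modn_small.
    by rewrite divnMDl // divn_small // addn0.
  split=> // X; split=> [EX|[x [alpha [Ex XE]]]].
    have [[u v] /= [[Eu XE] _]] := uniq X EX.
    by exists (fun n => (u n : nat)%:Z), v; split=> // n; rewrite XE -PoszM -PoszD.
  by apply/(EX_int _ _ XE); rewrite shift.
- split=> [E0|[n dNf]].
    apply: contrapT => /forallNP df.
    have : E !=set0 by apply/nonempty => n; exact/negPn/negP/df.
    by rewrite E0 => -[].
  apply: contrapT => /eqP/set0P/nonempty /(_ n).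
  by rewrite (negPf dNf).
Qed.
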